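(* Let $G$ be a weakly connected conjunctive Boolean network in which every vertex has at least one in-neighbor, let $H$ be its reduced system, let $x(0)$ be an initial condition of $G$, and let $y(0)$ be the induced initial condition of $H$. Let $x(t)$ and $y(t)$, $t\ge 0$, be the resulting trajectories of the systems $G$ and $H$. Then there exists a time step $N$ such that $x(N)$ and $y(N)$ are in periodic orbits of $G$ and $H$, respectively. Moreover, for any $t\ge N$, the following hold: 1. For any strongly connected component $G_i$ of $G$ and for all $j$ indexing the equivalence classes $[v_{i_j}]$ of $G_i$ ($j=0,1,\ldots,p_i-1$ if $p_i>0$, and $j=0$ if $p_i=0$), $$x_{[v_{i_j}]}(t)=y_{i_j}(t)\,\mathbf 1 .$$ 2. If the loop number $p_i$ of $G_i$ is positive, then $$y_{i_j}(t+1)=y_{i_{(j-1)\bmod p_i}}(t),\qquad \forall j=0,1,\ldots,p_i-1 .$$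
   Context: Conjunctive Boolean network (CBN). Let $\mathbb F_2=\{0,1\}$. All digraphs are finite; self-arcs are allowed. An edge $v_iv_j$ goes from $v_i$ to $v_j$; then $v_i$ is an in-neighbor of $v_j$ and $v_j$ an out-neighbor of $v_i$; $\mathcal N_{\rm in}(v)$, $\mathcal N_{\rm out}(v)$ are the sets of in- and out-neighbors of $v$, and $\mathcal N_{\rm out}(v;G')$ is the set of out-neighbors within a subgraph $G'$. The CBN with dependency graph $G=(V,E)$, $V=\{v_1,\dots,v_n\}$, is the dynamical system on $\mathbb F_2^{n}$ with synchronous update $x_i(t+1)=\prod_{v_j\in\mathcal N_{\rm in}(v_i)}x_j(t)$ for all $i$, where $x_i(t)$ is the value of vertex $v_i$ at time $t$. The update map is denoted $f$, so $x(t+1)=f(x(t))$. A CBN is identified with its dependency graph. A state $x(t_0)$ is in a periodic orbit if $x(t_0+p)=x(t_0)$ for some $p\ge1$; the least such $p$ is the period. For $V'\subseteq V$, $x_{V'}(t)$ is the restriction of $x(t)$ to $V'$; $\mathbf 1$ is the all-ones vector of appropriate dimension. Strong components, loop numbers, classes. Let $G_i=(V_i,E_i)$, $i=1,\dots,q$, be the (maximal, induced) strongly connected components of $G$. A single vertex, with or without self-arc, counts as strongly connected; a cycle is a closed walk with no repeated vertex except the start/end vertex (a self-arc is a cycle of length 1). The loop number $p_i$ of $G_i$ is the greatest common divisor of the lengths of all cycles in $G_i$, with $p_i=0$ if $G_i$ is a single vertex without self-arc. If $p_i>0$, define on $V_i$ the equivalence relation: $v\sim_{p_i}v'$ iff there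 is a path in $G_i$ from $v$ to $v'$ whose length is a multiple of $p_i$ (the length-0 path is allowed when $v=v'$); $[v]$ is the class of $v$. Fix $v_{i_0}\in V_i$ and $v_{i_j}\in\mathcal N_{\rm out}(v_{i_{j-1}};G_i)$ for $j=1,\dots,p_i-1$; then the classes $[v_{i_0}],\dots,[v_{i_{p_i-1}}]$ partition $V_i$. If $p_i=0$, $v_{i_0}$ is the single vertex of $G_i$ and $[v_{i_0}]=\{v_{i_0}\}$. Reduced system. The reduced system of $G$ is the CBN whose dependency graph $H=(U,F)$ is as follows. For each $i$ with $p_i>0$, $H$ contains a cycle $H_i=(U_i,F_i)$ with $U_i=\{u_{i_0},\dots,u_{i_{p_i-1}}\}$ and $F_i=\{u_{i_j}u_{i_{(j+1)\bmod p_i}}\mid j=0,\dots,p_i-1\}$; if $p_i=0$, $U_i=\{u_{i_0}\}$ and $F_i=\varnothing$. $U$ is the disjoint union of the $U_i$. Besides the edges in the $F_i$, for $i\ne i'$ there is an edge $u_{i_j}u_{i'_{j'}}$ in $H$ if and only if there is an edge $v'v''$ in $G$ with $v'\in[v_{i_j}]$ and $v''\in[v_{i'_{j'}}]$. States of $H$ are denoted $y$, with $y_{i_j}(t)$ the value of $u_{i_j}$ at time $t$. The induced initial condition of $H$ associated with $x(0)$ is $y_{i_j}(0):=\prod_{v_k\in[v_{i_j}]}x_k(0)$ for all $i,j$. *)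

(* Defs.v *)
From HB Require Import structures.
From mathcomp Require Import all_boot all_order all_algebra.

Set Implicit Arguments.
Unset Strict Implicit.
Unset Printing Implicit Defensive.

Import GRing.Theory.

(* A digraph on V is its adjacency relation: e v w means that vw is an edge;  *)
(* self-arcs are allowed.                                                     *)

Section Digraph.

Variables (V : finType) (e : rel V).

Definition weakly_connected : Prop :=
  forall v w : V, connect [rel a b | e a b || e b a] v w.

Definition strongly_related : rel V :=
  [rel v w | connect e v w && connect e w v].

Definition sccs : {set {set V}} :=
  equivalence_partition strongly_related [set: V].

Definition scc : finType := {C : {set V} | C \in sccs}.

Definition induced (S : {set V}) : rel V :=
  [rel v w | [&& v \in S, w \in S & e v w]].

(* A cycle has no repeated vertex, hence length at most #|V|. The gcd of the  *)
(* empty family is 0, the value wanted for a single vertex without self-arc.  *)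
Definition loop_number (S : {set V}) : nat :=
  \big[gcdn/0]_(k < #|V|.+1 |
      (0 < k) && [exists c : k.-tuple V, ucycleb (induced S) c]) k.

(* A path is a walk without repeated vertices, hence has fewer than #|V|      *)
(* edges; k is the number of edges. For loop number 0, only k = 0 is a        *)
(* multiple, so that the class of v is {v}.                                   *)
Definition period_equiv (S : {set V}) : rel V :=
  [rel v w | [exists k : 'I_#|V|, (loop_number S %| k) &&
    [exists s : k.-tuple V,
       [&& path (induced S) v s, uniq (v :: s) & last v s == w]]]].

Definition period_class (S : {set V}) (v : V) : {set V} :=
  [set w in S | period_equiv S v w].

Definition loop (i : scc) : nat := loop_number (val i).

(* There are p_i classes when p_i > 0, and a single one when p_i = 0. Thus,   *)
(* for p_i > 0, ord_pred on 'I_(nclass i) is j |-> (j - 1) mod p_i.           *)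
Definition nclass (i : scc) : nat := maxn 1 (loop i).

Definition reduced_vertex : finType := {i : scc & 'I_(nclass i)}.

Definition rvertex (i : scc) (j : 'I_(nclass i)) : reduced_vertex :=
  Tagged (fun i : scc => 'I_(nclass i)) j.

(* rep (rvertex j), for j : 'I_(nclass i), is v_{i_j}.                        *)
Definition is_representatives (rep : reduced_vertex -> V) : Prop :=
  forall (i : scc) (j : 'I_(nclass i)),
    rep (rvertex j) \in val i /\
    forall j' : 'I_(nclass i), j' = j.+1 :> nat ->
      e (rep (rvertex j)) (rep (rvertex j')).

Definition rep_class (rep : reduced_vertex -> V) (u : reduced_vertex) :
    {set V} :=
  period_class (val (tag u)) (rep u).

Definition reduced_graph (rep : reduced_vertex -> V) : rel reduced_vertex :=
  [rel u u' : reduced_vertex |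
    if tag u == tag u' then
      (0 < loop (tag u)) &&
      (nat_of_ord (tagged u') == (nat_of_ord (tagged u)).+1 %% loop (tag u))
    else
      [exists v in rep_class rep u, exists w in rep_class rep u', e v w]].

End Digraph.

Local Open Scope ring_scope.

Definition state (V : finType) := {ffun V -> 'F_2}.

Definition cbn (V : finType) (e : rel V) (x : state V) : state V :=
  [ffun v => \prod_(w | e w v) x w].

Definition trajectory (V : finType) (e : rel V) (x0 : state V) (t : nat) :
    state V :=
  iter t (cbn e) x0.

Definition in_periodic_orbit (V : finType) (e : rel V) (x : state V) : Prop :=
  exists2 p : nat, (0 < p)%N & trajectory e x p = x.

Definition induced_state (V : finType) (e : rel V)
    (rep : reduced_vertex e -> V) (x : state V) : state (reduced_vertex e) :=
  [ffun u => \prod_(v in rep_class rep u) x v].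

(* Main.v *)
(* A component of x vanishes at time t iff some walk of length t reaches it   *)
(* from a vertex vanishing at time 0. A walk of G projects to a walk of H, so *)
(* y vanishes wherever x does. Conversely, a walk of H lifts to a walk of G   *)
(* after inserting, in each component met, a walk joining two vertices of the *)
(* same class; by Bezout, its length can be chosen divisible by any given     *)
(* P > 0. With P a period of the limit cycle of x, the lift leads to a zero   *)
(* of x at time t + k * P, hence at time t once x is periodic.                *)

Require Import Defs.
From mathcomp Require Import all_boot all_order all_algebra.

Set Implicit Arguments.
Unset Strict Implicit.
Unset Printing Implicit Defensive.

Import GRing.Theory.

(** Over ['F_2] a state is determined by its zeros ([F2_eq]), and a product vanishes iff a factor
    does ([trajectoryS_eq0P]), so the dynamics is the spreading of zeros along walks. For claim 1,
    [trajectory_le_reduced] carries zeros from G to H without delay, and [reduced_le_trajectory]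
    carries them back with a delay [k * P] that periodicity absorbs. The way back rests on
    [period_class_walk]: two vertices of one class are joined by a walk of length divisible by [P].
    For claim 2, zeros travel around the cycle of each component ([reduced_trajectory_shift]). Edges
    from other components could add zeros, but an added zero would keep circulating, and periodicity
    of [y] forces it to have been there one turn earlier. *)

(** * Walks *)

Definition walk (V : finType) (e : rel V) (n : nat) (v w : V) : Prop :=
  exists s : seq V, [/\ path e v s, size s = n & last v s = w].

Lemma walk0 (V : finType) (e : rel V) (v : V) : walk e 0 v v.
Proof. by exists [::]. Qed.

Lemma walk_cat (V : finType) (e : rel V) (m n : nat) (u v w : V) :
  walk e m u v -> walk e n v w -> walk e (m + n) u w.
Proof.
move=> [s [es <- <-]] [t [et <- <-]]; exists (s ++ t).
by rewrite cat_path es et size_cat last_cat.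
Qed.

Lemma walk1 (V : finType) (e : rel V) (v w : V) : e v w -> walk e 1 v w.
Proof. by move=> evw; exists [:: w]; rewrite /= evw. Qed.

Lemma walk_mul (V : finType) (e : rel V) (k n : nat) (v : V) :
  walk e n v v -> walk e (k * n) v v.
Proof.
move=> wn; elim: k => [|k IHk]; first exact: walk0.
by rewrite mulSn; apply: walk_cat IHk.
Qed.

Lemma walk_connect (V : finType) (e : rel V) (n : nat) (v w : V) :
  walk e n v w -> connect e v w.
Proof. by case=> s [es _ <-]; apply/connectP; exists s. Qed.

Lemma connect_walk (V : finType) (e : rel V) (v w : V) :
  connect e v w -> exists n, walk e n v w.
Proof. by case/connectP=> s es ->; exists (size s), s. Qed.

(** * Cycles, strong components and loop numbers *)

Lemma not_uniq_split (T : eqType) (s : seq T) :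
  ~~ uniq s -> exists x s1 s2 s3, s = s1 ++ x :: s2 ++ x :: s3.
Proof.
elim: s => [//|x s IHs] /=; rewrite negb_and negbK.
case/orP=> [/splitPr[s2 s3]|/IHs[y [s1 [s2 [s3 ->]]]]].
  by exists x, [::], s2, s3.
by exists y, (x :: s1), s2, s3.
Qed.

(** Two occurrences of a repeated vertex split a closed walk into two strictly shorter closed walks.
    This extends divisibility by the loop number from simple cycles to all closed walks. *)
Lemma dvdn_cycle (T : eqType) (r : rel T) (d : nat) :
  (forall c, ucycle r c -> d %| size c) -> forall c, cycle r c -> d %| size c.
Proof.
move=> dvd_u c; have [n] := ubnP (size c).
elim: n c => // n IHn c; rewrite ltnS => le_cn rc.
have [uc|] := boolP (uniq c); first by apply: dvd_u; apply/andP.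
case/not_uniq_split=> x [s1 [s2 [s3 def_c]]].
(* Rotating by [size s1] puts the first occurrence of [x] in front. *)
move: rc; rewrite -(rot_cycle (size s1)) def_c rot_size_cat /=.
rewrite -catA rcons_cat cat_path /= => /andP[rs2 /andP[rx r31]].
have sz_c : size c = size (x :: s2) + size (x :: s3 ++ s1).
  by rewrite def_c /= !size_cat /= size_cat /= !addnS !addSn addnC addnA.
rewrite -def_c sz_c; apply: dvdn_add; apply: IHn.
- by apply: leq_trans le_cn; rewrite sz_c /= addnS ltnS leq_addr.
- by rewrite /= rcons_path rs2.
- by apply: leq_trans le_cn; rewrite sz_c /= addSn ltnS leq_addl.
- exact: r31.
Qed.

Lemma in_scc (V : finType) (e : rel V) (S : {set V}) (v w : V) :
  S \in sccs e -> v \in S -> (w \in S) = connect e v w && connect e w v.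
Proof.
case/imsetP=> x _ ->; rewrite !inE /= => /andP[xv vx].
apply/andP/andP=> -[] ? ?; split; apply: connect_trans; eassumption.
Qed.

(** A walk that leaves a strong component never returns. Hence walks of the whole graph can replace
    walks of [induced e S] from here on. *)
Lemma path_in_scc (V : finType) (e : rel V) (S : {set V}) (v : V) (s : seq V) :
  S \in sccs e -> v \in S -> path e v s -> last v s \in S ->
  path (induced e S) v s.
Proof.
move=> Scc; elim: s v => //= a s IHs v Sv /andP[eva es] Sl.
have Sa: a \in S.
  rewrite (in_scc a Scc Sv) connect1 //=.
  apply: (@connect_trans _ _ (last a s)); first by apply/connectP; exists s.
  by move: Sl; rewrite (in_scc _ Scc Sv) => /andP[].
by rewrite /induced /= Sv Sa eva; apply: IHs.
Qed.

Lemma walk_in_scc (V : finType) (e : rel V) (S : {set V}) (v w : V) :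
  S \in sccs e -> v \in S -> w \in S -> exists n, walk e n v w.
Proof.
by move=> Scc Sv; rewrite (in_scc w Scc Sv) => /andP[/connect_walk].
Qed.

Lemma loop_number_dvd_ucycle (V : finType) (e : rel V) (S : {set V}) c :
  ucycle (induced e S) c -> loop_number e S %| size c.
Proof.
move=> uc; have [->|nz_c] := posnP (size c); first exact: dvdn0.
have lt_c: size c < #|V|.+1.
  by rewrite ltnS -(card_uniqP (ucycle_uniq uc)) max_card.
apply: (@biggcdn_inf _ (Ordinal lt_c)) => //=; rewrite nz_c /=.
by apply/existsP; exists (in_tuple c); exact: uc.
Qed.

Lemma loop_number_dvd_walk (V : finType) (e : rel V) (S : {set V}) n v :
  S \in sccs e -> v \in S -> walk e n v v -> loop_number e S %| n.
Proof.
move=> Scc Sv [s [es <- lst]].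
have: path (induced e S) v s by apply: path_in_scc; rewrite ?lst.
case/lastP: s lst {es} => [//|s x]; rewrite last_rcons => -> es.
rewrite size_rcons.
exact: (dvdn_cycle (@loop_number_dvd_ucycle _ e S) (c := v :: s)).
Qed.

(** Both walks are closed up by the same return walk from [w] to [v]. *)
Lemma walk_eqmod (V : finType) (e : rel V) (S : {set V}) m n v w :
  S \in sccs e -> v \in S -> w \in S -> walk e m v w -> walk e n v w ->
  m == n %[mod loop_number e S].
Proof.
move=> Scc Sv Sw wm wn; have [r wr] := walk_in_scc Scc Sw Sv.
rewrite -(eqn_modDr r) (eqP (_ : loop_number e S %| m + r)).
  rewrite eq_sym.
  exact: loop_number_dvd_walk Scc Sv (walk_cat wn wr).
exact: loop_number_dvd_walk Scc Sv (walk_cat wm wr).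
Qed.

(** By [walk_eqmod] any single walk decides membership; shortening it yields the repetition-free
    path that the definition asks for. *)
Lemma mem_period_class (V : finType) (e : rel V) (S : {set V}) n v w :
  S \in sccs e -> v \in S -> w \in S -> walk e n v w ->
  (w \in period_class e S v) = (loop_number e S %| n).
Proof.
move=> Scc Sv Sw wn; rewrite inE Sw /=.
apply/existsP/idP => [[k /andP[dvd_k /existsP[s /and3P[es _ /eqP ls]]]]|dvd_n].
  have wk: walk e k v w.
    exists s; split=> //; last exact: size_tuple.
    by apply: sub_path es => a b /and3P[].
  by rewrite /dvdn -(eqP (walk_eqmod Scc Sv Sw wk wn)).
case: wn (wn) => s [es _ ls] wn.
case/shortenP: es ls => s' es' us' _ ls.
have lt_s': size s' < #|V|.
  by rewrite -[(size s').+1]/(size (v :: s')) -(card_uniqP us') max_card.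
have ws': walk e (size s') v w by exists s'.
exists (Ordinal lt_s') => /=.
rewrite {1}/dvdn (eqP (walk_eqmod Scc Sv Sw ws' wn)) -/(dvdn _ _) dvd_n /=.
apply/existsP; exists (in_tuple s'); apply/and3P; split=> //; last exact/eqP.
by apply: path_in_scc; rewrite ?ls.
Qed.

(* Closed walk lengths at v, taken modulo P, are closed under subtraction:    *)
(* a difference a - b is a + (P - 1) * b modulo P.                            *)
Lemma closed_walk_gcd (V : finType) (e : rel V) (P a b m n : nat) (v : V) :
  0 < P -> walk e m v v -> m = a %[mod P] -> walk e n v v -> n = b %[mod P] ->
  exists2 l, walk e l v v & l = gcdn a b %[mod P].
Proof.
move=> P_gt0 wm eq_ma wn eq_nb.
have [a0|a_gt0] := posnP a; first by exists n; rewrite // a0 gcd0n.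
have [c _ /dvdnP[q def_q]] := Bezoutl b a_gt0.
exists (q * m + (P.-1 * c) * n).
  by apply: walk_cat; apply: walk_mul.
rewrite -modnDm -[q * m %% P]modnMmr -[_ * n %% P]modnMmr eq_ma eq_nb !modnMmr.
rewrite modnDm -def_q -addnA -mulnA -mulSn prednK //.
by rewrite addnC mulnC modnMDl.
Qed.

Lemma closed_walk_loop (V : finType) (e : rel V) (S : {set V}) (P : nat) v :
  S \in sccs e -> v \in S -> 0 < P ->
  exists2 l, walk e l v v & l = loop_number e S %[mod P].
Proof.
move=> Scc Sv P_gt0; rewrite /loop_number.
apply: (big_rec (fun d => exists2 l, walk e l v v & l = d %[mod P])) =>
  [|k d /andP[k_gt0 /existsP[c]] uc [n wn eq_n]].
  by exists 0; first exact: walk0.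
case: c uc => [[|a c] sz_c]; first by rewrite -(eqP sz_c) in k_gt0.
move=> /andP[/= cyc_c _].
have wk: walk e k a a.
  exists (rcons c a); rewrite last_rcons size_rcons; split=> //; last exact/eqP.
  by apply: sub_path cyc_c => x y /and3P[].
have Sa: a \in S by case: (c) cyc_c => [|x c'] /= /andP[/and3P[]].
have [r wr] := walk_in_scc Scc Sv Sa; have [s ws] := walk_in_scc Scc Sa Sv.
(* The detour from [v] to the cycle and back costs [r + s]; repeating it [P.-1] more times makes its
   total cost a multiple of [P]. *)
have wP := walk_mul P.-1 (walk_cat wr ws).
have wk' := walk_cat (walk_cat wr (walk_cat wk ws)) wP.
apply: (closed_walk_gcd P_gt0 wk' _ wn eq_n).
rewrite addnCA -addnA -mulSn prednK //.
by rewrite addnC mulnC modnMDl.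
Qed.

(** A walk from [v] to [w] has length [n = q * loop_number e S]. Appending [P.-1 * q] closed walks
    of length congruent to the loop number gives a total of [P * n] modulo [P]. *)
Lemma period_class_walk (V : finType) (e : rel V) (S : {set V}) P a v w :
  S \in sccs e -> a \in S -> 0 < P ->
  v \in period_class e S a -> w \in period_class e S a ->
  exists k, walk e (k * P) v w.
Proof.
move=> Scc Sa P_gt0 Cv Cw.
have Sv: v \in S by case/setIdP: Cv.
have Sw: w \in S by case/setIdP: Cw.
have [m wm] := walk_in_scc Scc Sa Sv; have [n wn] := walk_in_scc Scc Sv Sw.
have dvd_n: loop_number e S %| n.
  rewrite (mem_period_class Scc Sa Sv wm) in Cv.
  rewrite (mem_period_class Scc Sa Sw (walk_cat wm wn)) in Cw.
  by rewrite -(dvdn_addr _ Cv).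
have [q def_n] := dvdnP dvd_n.
have [l wl eq_l] := closed_walk_loop Scc Sw P_gt0.
have wt := walk_cat wn (walk_mul (P.-1 * q) wl).
suff /dvdnP[k def_k]: P %| n + P.-1 * q * l by exists k; rewrite -def_k.
rewrite /dvdn -modnDmr -[_ * l %% P]modnMmr eq_l modnMmr modnDmr.
by rewrite -mulnA -def_n -mulSn prednK // modnMr.
Qed.

(** * Indexing of the classes of a component *)

Lemma nclass_gt0 (V : finType) (e : rel V) (i : scc e) : 0 < nclass i.
Proof. exact: leq_maxl. Qed.

Lemma nclass_loop (V : finType) (e : rel V) (i : scc e) :
  0 < loop i -> nclass i = loop i.
Proof. by move/maxn_idPr. Qed.

Lemma ord_loop0 (V : finType) (e : rel V) (i : scc e) (j : 'I_(nclass i)) :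
  loop i = 0 -> j = 0 :> nat.
Proof.
by case: j => -[|j] //=; rewrite /nclass => + i0; rewrite i0.
Qed.

Definition base (V : finType) (e : rel V) (rep : reduced_vertex e -> V)
    (i : scc e) : V :=
  rep (rvertex (Ordinal (nclass_gt0 i))).

Lemma rep_in_scc (V : finType) (e : rel V) (rep : reduced_vertex e -> V)
    (i : scc e) (j : 'I_(nclass i)) :
  is_representatives rep -> rep (rvertex j) \in val i.
Proof. by move=> rep_ok; case: (rep_ok i j). Qed.

Lemma walk_base_rep (V : finType) (e : rel V) (rep : reduced_vertex e -> V)
    (i : scc e) (j : 'I_(nclass i)) :
  is_representatives rep -> walk e j (base rep i) (rep (rvertex j)).
Proof.
move=> rep_ok; case: j => j; elim: j => [|j IHj] lt_j /=.
  rewrite /base (bool_irrelevance (nclass_gt0 i) lt_j); exact: walk0.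
have [_ e_next] := rep_ok i (Ordinal (ltnW lt_j)).
have := walk_cat (IHj (ltnW lt_j)) (walk1 (e_next (Ordinal lt_j) erefl)).
by rewrite addn1.
Qed.

(** The index of a class is a residue: since [rep (rvertex j)] lies [j] steps after [base rep i],
    the class of [v] is read off the length of any walk from the base. *)
Lemma mem_rep_class (V : finType) (e : rel V) (rep : reduced_vertex e -> V)
    (i : scc e) (j : 'I_(nclass i)) n v :
  is_representatives rep -> v \in val i -> walk e n (base rep i) v ->
  (v \in rep_class rep (rvertex j)) = (n == j %[mod loop i]).
Proof.
move=> rep_ok Sv wn; have Scc := valP i.
have Sb: base rep i \in val i by apply: rep_in_scc.
have Sj: rep (rvertex j) \in val i by apply: rep_in_scc.
have [m wm] := walk_in_scc Scc Sj Sv.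
rewrite /rep_class /= (mem_period_class Scc Sj Sv wm).
have wjm := walk_cat (walk_base_rep j rep_ok) wm.
rewrite (eqP (walk_eqmod Scc Sb Sv wn wjm)).
by rewrite -[X in _ == X %[mod _]]addn0 eqn_modDl mod0n.
Qed.

Lemma rep_class_in_scc (V : finType) (e : rel V) (rep : reduced_vertex e -> V)
    (i : scc e) (j : 'I_(nclass i)) v :
  v \in rep_class rep (rvertex j) -> v \in val i.
Proof. by case/setIdP. Qed.

Lemma scc_rep_class_cover (V : finType) (e : rel V)
    (rep : reduced_vertex e -> V) (i : scc e) v :
  is_representatives rep -> v \in val i ->
  exists j : 'I_(nclass i), v \in rep_class rep (rvertex j).
Proof.
move=> rep_ok Sv.
have Sb: base rep i \in val i by apply: rep_in_scc.
have [n wn] := walk_in_scc (valP i) Sb Sv.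
have lt_n: n %% loop i < nclass i.
  (* For loop number 0, reduction modulo 0 leaves [n] unchanged, and [n] is 0 because every closed
     walk is empty. *)
  have [i0|i_gt0] := posnP (loop i); last by rewrite nclass_loop ?ltn_mod.
  have [m wm] := walk_in_scc (valP i) Sv Sb.
  have := loop_number_dvd_walk (valP i) Sb (walk_cat wn wm).
  rewrite -/(loop i) i0 dvd0n addn_eq0 => /andP[/eqP-> _].
  by rewrite mod0n nclass_gt0.
exists (Ordinal lt_n).
by rewrite (mem_rep_class _ rep_ok Sv wn) /= modn_mod.
Qed.

Lemma rep_class_cover (V : finType) (e : rel V)
    (rep : reduced_vertex e -> V) v :
  is_representatives rep -> exists u, v \in rep_class rep u.
Proof.
move=> rep_ok.
have Scc: [set w in [set: V] | strongly_related e v w] \in sccs e.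
  by apply: imset_f.
have Sv: v \in val (exist (fun C => C \in sccs e) _ Scc : scc e).
  by rewrite inE in_setT /strongly_related /= connect0.
by have [j Cv] := scc_rep_class_cover rep_ok Sv; exists (rvertex j).
Qed.

(** An edge lengthens a walk from the base by one; closed up by a return walk, it also gives a
    nonempty closed walk, so the loop number is positive. *)
Lemma edge_rep_class (V : finType) (e : rel V) (rep : reduced_vertex e -> V)
    (i : scc e) (j j' : 'I_(nclass i)) v w :
  is_representatives rep -> v \in rep_class rep (rvertex j) ->
  w \in rep_class rep (rvertex j') -> e v w ->
  0 < loop i /\ j' = j.+1 %% loop i :> nat.
Proof.
move=> rep_ok Cv Cw evw.
have Sv := rep_class_in_scc Cv; have Sw := rep_class_in_scc Cw.
have Sb: base rep i \in val i by apply: rep_in_scc.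
have i_gt0: 0 < loop i.
  have [m wm] := walk_in_scc (valP i) Sw Sv.
  have := loop_number_dvd_walk (valP i) Sv (walk_cat (walk1 evw) wm).
  by rewrite -/(loop i); case: posnP => // ->.
split=> //; have [n wn] := walk_in_scc (valP i) Sb Sv.
rewrite (mem_rep_class _ rep_ok Sv wn) in Cv.
rewrite (mem_rep_class _ rep_ok Sw (walk_cat wn (walk1 evw))) in Cw.
have lt_j': j' < loop i by rewrite -nclass_loop.
rewrite -(modn_small lt_j') -(eqP Cw) -modnDml (eqP Cv) modnDml.
by rewrite addn1.
Qed.

(** * Edges of the reduced graph *)

Lemma reduced_graph_edge (V : finType) (e : rel V)
    (rep : reduced_vertex e -> V) (u u' : reduced_vertex e) v w :
  is_representatives rep -> v \in rep_class rep u -> w \in rep_class rep u' ->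
  e v w -> reduced_graph rep u u'.
Proof.
case: u u' => [i j] [i' j'] rep_ok Cv Cw evw; rewrite /reduced_graph /=.
case: eqP => [ii'|_]; last first.
  by apply/existsP; exists v; rewrite Cv; apply/existsP; exists w; rewrite Cw.
case: i' / ii' j' Cw => j' Cw.
by have [-> ->] := edge_rep_class rep_ok Cv Cw evw; rewrite eqxx.
Qed.

(** Edges inside a component of H are defined by indices alone, so an edge of G must be found: the
    last edge of a nonempty closed walk at the representative of the target class. *)
Lemma reduced_graph_in_edge (V : finType) (e : rel V)
    (rep : reduced_vertex e -> V) (u u' : reduced_vertex e) :
  is_representatives rep -> reduced_graph rep u u' ->
  exists v w, [/\ v \in rep_class rep u, w \in rep_class rep u' & e v w].
Proof.
case: u u' => [i j] [i' j'] rep_ok; rewrite /reduced_graph /=.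
case: eqP => [ii'|_]; last first.
  case/existsP=> v /andP[Cv /existsP[w /andP[Cw evw]]].
  by exists v, w.
case: i' / ii' j' => j' /andP[i_gt0 /eqP def_j'].
set w := rep (rvertex j').
have Sw: w \in val i by apply: rep_in_scc.
have Cw: w \in rep_class rep (rvertex j').
  by rewrite /rep_class /= (mem_period_class (valP i) Sw Sw (walk0 e w)).
(* With modulus [(loop i).+1] the residue of [l] is [loop i > 0], which rules out the empty walk. *)
have [l wl eq_l] := closed_walk_loop (valP i) Sw (ltn0Sn (loop i)).
case: wl => s [es sz_s lst].
case/lastP: s es sz_s lst => [_ sz_s _|s x].
  move: eq_l; rewrite -sz_s mod0n modn_small // => l0.
  by rewrite /loop -l0 in i_gt0.
rewrite last_rcons rcons_path size_rcons => /andP[es evw] _ def_x.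
rewrite def_x in evw; set v := last w s in evw.
have Sv: v \in val i.
  rewrite (in_scc v (valP i) Sw) (connect1 evw) andbT.
  by apply/connectP; exists s.
exists v, w; split=> //.
have [k Cv] := scc_rep_class_cover rep_ok Sv.
suff ->: j = k by [].
have [_ def_k] := edge_rep_class rep_ok Cv Cw evw.
have: j.+1 == k.+1 %[mod loop i] by rewrite -def_j' -def_k.
rewrite -addn1 -[k.+1]addn1 eqn_modDr -nclass_loop // !modn_small //.
by move/eqP/val_inj.
Qed.

(** * Propagation of zeros and eventual periodicity *)

Lemma trajectoryD (V : finType) (e : rel V) (x : state V) m n :
  trajectory e x (m + n) = trajectory e (trajectory e x m) n.
Proof. by rewrite /trajectory addnC iterD. Qed.

Lemma trajectoryS_eq0P (V : finType) (e : rel V) (x : state V) t v :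
  reflect (exists2 w, e w v & trajectory e x t w == 0%R)
          (trajectory e x t.+1 v == 0%R).
Proof. by rewrite /trajectory iterS ffunE; apply: prodf_eq0. Qed.

Lemma walk_trajectory_eq0 (V : finType) (e : rel V) (x : state V) t n v w :
  walk e n v w -> trajectory e x t v == 0%R ->
  trajectory e x (t + n) w == 0%R.
Proof.
case=> s [es <- <-]; elim: s t v es => [|a s IHs] t v /=.
  by rewrite addn0.
case/andP=> eva es x0; rewrite addnS -addSn; apply: IHs es _.
by apply/trajectoryS_eq0P; exists v.
Qed.

Lemma F2_eq (a b : 'F_2) : (a == 0%R) = (b == 0%R) -> a = b.
Proof. by case: a b => [[|[|a]] ?] [[|[|b]] ?] // _; apply: val_inj. Qed.

Lemma trajectory_eventually_periodic (V : finType) (e : rel V) (x : state V) :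
  exists N P, 0 < P /\
    forall t k, N <= t -> trajectory e x (t + k * P) = trajectory e x t.
Proof.
(* The state space is finite: the state at time [order (cbn e) x] repeats the one at some earlier
   time [N]. *)
have /trajectP[N lt_N def_N] := looping_order (cbn e) x.
set m := order _ _ in lt_N def_N.
exists N, (m - N); split=> [|t k le_Nt]; first by rewrite subn_gt0.
have per_t: trajectory e x (t + (m - N)) = trajectory e x t.
  rewrite -[in RHS](subnKC le_Nt) -{1}(subnKC le_Nt) addnAC subnKC 1?ltnW //.
  by rewrite !trajectoryD /trajectory -def_N.
elim: k => [|k IHk]; first by rewrite addn0.
by rewrite mulSn addnA trajectoryD per_t -trajectoryD.
Qed.

(** * Comparison of the two systems *)

Lemma trajectory_le_reduced (V : finType) (e : rel V)
    (rep : reduced_vertex e -> V) (x0 : state V) t u v :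
  is_representatives rep -> v \in rep_class rep u ->
  trajectory e x0 t v == 0%R ->
  trajectory (reduced_graph rep) (induced_state rep x0) t u == 0%R.
Proof.
move=> rep_ok; elim: t u v => [|t IHt] u v Cv.
  by move=> xv; rewrite /trajectory /= ffunE; apply/prodf_eq0; exists v.
case/trajectoryS_eq0P=> w ewv xw; have [u' Cw] := rep_class_cover w rep_ok.
apply/trajectoryS_eq0P; exists u'; last exact: IHt Cw xw.
exact: reduced_graph_edge Cw Cv ewv.
Qed.

Lemma reduced_le_trajectory (V : finType) (e : rel V)
    (rep : reduced_vertex e -> V) (x0 : state V) P t u v :
  is_representatives rep -> 0 < P -> v \in rep_class rep u ->
  trajectory (reduced_graph rep) (induced_state rep x0) t u == 0%R ->
  exists k, trajectory e x0 (t + k * P) v == 0%R.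
Proof.
move=> rep_ok P_gt0.
(* A lifted edge starts and ends at uncontrolled members of its classes; [spread] moves a zero to
   the prescribed member at the cost of a delay divisible by [P]. *)
have spread u' a b s : a \in rep_class rep u' -> b \in rep_class rep u' ->
    trajectory e x0 s a == 0%R ->
    exists k, trajectory e x0 (s + k * P) b == 0%R.
  case: u' => i j Ca Cb xa.
  have [k wk] :=
    period_class_walk (valP i) (rep_in_scc j rep_ok) P_gt0 Ca Cb.
  by exists k; apply: walk_trajectory_eq0 wk xa.
elim: t u v => [|t IHt] u v Cv.
  rewrite {1}/trajectory /= ffunE => /prodf_eq0[w Cw xw].
  exact: (spread u w v 0).
case/trajectoryS_eq0P=> u' uu' yu'.
have [a [b [Ca Cb eab]]] := reduced_graph_in_edge rep_ok uu'.
have [k xa] := IHt _ _ Ca yu'.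
have [l xv] := spread _ _ _ _ Cb Cv (walk_trajectory_eq0 (walk1 eab) xa).
by exists (k + l); move: xv; rewrite addn1 mulnDl addnA addSn.
Qed.

Lemma reduced_trajectory_shift (V : finType) (e : rel V)
    (rep : reduced_vertex e -> V) (y0 : state (reduced_vertex e)) (i : scc e)
    (j : 'I_(nclass i)) n t :
  0 < loop i -> trajectory (reduced_graph rep) y0 t (rvertex j) == 0%R ->
  trajectory (reduced_graph rep) y0 (t + n)
    (rvertex (iter n (@ordS _) j)) == 0%R.
Proof.
move=> i_gt0 yj; elim: n => [|n IHn]; first by rewrite addn0.
rewrite addnS; apply/trajectoryS_eq0P.
exists (rvertex (iter n (@ordS _) j)) => //.
by rewrite /reduced_graph /= eqxx i_gt0 -(nclass_loop i_gt0) /= eqxx.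
Qed.

Lemma iter_ordS (n k : nat) (j : 'I_n) :
  iter k (@ordS n) j = (j + k) %% n :> nat.
Proof.
elim: k => [|k IHk] /=; first by rewrite addn0 modn_small.
by rewrite IHk -addn1 modnDml addn1 addnS.
Qed.

Theorem theorem1 (V : finType) (e : rel V)
    (wconn : weakly_connected e)
    (has_in : forall v : V, exists w : V, e w v)
    (rep : reduced_vertex e -> V) (rep_ok : is_representatives rep)
    (x0 : state V) :
  let x := trajectory e x0 in
  let y := trajectory (reduced_graph rep) (induced_state rep x0) in
  exists N : nat,
    [/\ in_periodic_orbit e (x N),
        in_periodic_orbit (reduced_graph rep) (y N)
      & forall t : nat, N <= t ->
          (forall (i : scc e) (j : 'I_(nclass i)) (v : V),
              v \in rep_class rep (rvertex j) -> x t v = y t (rvertex j))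
          /\
          (forall i : scc e, 0 < loop i ->
             forall j : 'I_(nclass i),
               y t.+1 (rvertex j) = y t (rvertex (ord_pred j)))].
Proof.
move=> x y.
have [Nx [Px [Px_gt0 per_x]]] := trajectory_eventually_periodic e x0.
have [Ny [Py [Py_gt0 per_y]]] :=
  trajectory_eventually_periodic (reduced_graph rep) (induced_state rep x0).
exists (maxn Nx Ny); split.
- exists Px => //; rewrite -trajectoryD -[Px]mul1n; exact: per_x (leq_maxl _ _).
- exists Py => //; rewrite -trajectoryD -[Py]mul1n; exact: per_y (leq_maxr _ _).
move=> t; rewrite geq_max => /andP[le_Nxt le_Nyt]; split=> [i j v Cv|i i_gt0 j].
  apply: F2_eq; apply/idP/idP; first exact: trajectory_le_reduced.
  (* Lifting with [P := Px] makes the delay a multiple of the period of [x]. *)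
  case/(reduced_le_trajectory rep_ok Px_gt0 Cv)=> k.
  by rewrite per_x.
apply: F2_eq; apply/idP/idP => [yj|yj]; last first.
  by have := reduced_trajectory_shift 1 i_gt0 yj; rewrite addn1 /= ord_predK.
(* Going once around the cycle of component i takes [loop i] steps, so Py     *)
(* turns starting at j at time t + 1 lead to the predecessor of j at time     *)
(* t + loop i * Py.                                                           *)
have nPy_gt0: 0 < loop i * Py by rewrite muln_gt0 i_gt0.
have := reduced_trajectory_shift (loop i * Py).-1 i_gt0 yj.
rewrite addSn -addnS prednK // per_y //.
suff ->: iter (loop i * Py).-1 (@ordS _) j = ord_pred j by [].
(* After one more [ordS] on both sides, the claim is that [Py] full turns fix [j]. *)
apply: (can_inj (@ordSK _)); rewrite ord_predK -iterS prednK //.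
apply: val_inj; rewrite /= iter_ordS -(nclass_loop i_gt0).
by rewrite addnC mulnC modnMDl modn_small.
Qed.
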